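(* For each nonnegative integer $k$, there is a bijection $\Upsilon_k:\mathcal U_{2k+1}(312,1342)\to\mathrm{Int}(\mathrm{NC}_k)$.
   Context: The stack-sorting map $s$ on permutations (finite words of distinct positive integers): $s(\text{empty})=\text{empty}$, and if $\pi=LnR$ with $n$ the largest entry, $s(\pi)=s(L)s(R)n$. A permutation is uniquely sorted if it has exactly one preimage under $s$. A permutation avoids $\tau$ if no subsequence has the same relative order as $\tau$; $\mathcal U_n(\tau^{(1)},\tau^{(2)})$ is the set of uniquely sorted permutations of $[n]$ avoiding both patterns. A set partition of $[k]$ is noncrossing if there are no two distinct blocks $B,B'$ with $a,c\in B$, $b,d\in B'$ and $a<b<c<d$. $\mathrm{NC}_k$ is the poset of noncrossing partitions of $[k]$ ordered by refinement ($\rho\le\kappa$ iff every block of $\rho$ is contained in a block of $\kappa$), with the convention $\mathrm{NC}_0=\{\emptyset\}$. $\mathrm{Int}(P)$ is the set of pairs $(x,y)$ with $x\le y$ in $P$. *)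

(* Defs.v *)
From HB Require Import structures.
(* In this order, so that the finset names shadow those of classical_sets. *)
From mathcomp Require Import classical_sets functions.
From mathcomp Require Import all_boot all_order.

Set Implicit Arguments.
Unset Strict Implicit.
Unset Printing Implicit Defensive.

Import Order.TTheory.

(** * Permutations and stack-sorting *)

Definition is_permutation (w : seq nat) : bool :=
  uniq w && all (fun x => 0 < x) w.

(* The first argument is fuel; [size w] always suffices, so that [stack_sort]
   obeys the recursion proved in [stack_sort0] and [stack_sort_cat]. *)
Fixpoint stack_sort_rec (fuel : nat) (w : seq nat) : seq nat :=
  if fuel is m.+1 then
    if w is [::] then [::] else
    let n := \max_(x <- w) x in
    let i := index n w in
    stack_sort_rec m (take i w) ++ stack_sort_rec m (drop i.+1 w) ++ [:: n]
  else [::].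

Definition stack_sort (w : seq nat) : seq nat := stack_sort_rec (size w) w.

Lemma bigmax_mem (w : seq nat) : w != [::] -> \max_(x <- w) x \in w.
Proof.
elim: w => // a w IHw _; rewrite big_cons inE.
case: (eqVneq w [::]) => [->|/IHw IH]; first by rewrite big_nil maxn0 eqxx.
by case: leqP => _; rewrite ?IH ?eqxx ?orbT.
Qed.

Lemma stack_sort_rec_fuel (m : nat) (w : seq nat) :
  size w <= m -> stack_sort_rec m w = stack_sort w.
Proof.
rewrite /stack_sort.
have [b le_wb] := ubnP (size w); elim: b m w le_wb => // b IH m [|a w] le_wb.
  by case: m.
case: m => // m le_wm.
set v := a :: w in le_wb le_wm *.
have iv : index (\max_(x <- v) x) v < size v by rewrite index_mem bigmax_mem.
have sL : size (take (index (\max_(x <- v) x) v) v) <= size w.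
  by rewrite size_take iv -ltnS.
have sR : size (drop (index (\max_(x <- v) x) v).+1 v) <= size w.
  by rewrite size_drop /= subSS leq_subr.
rewrite [stack_sort_rec m.+1 v]/= [stack_sort_rec (size v) v]/= -/v.
have wb : size w < b by [].
have wm : size w <= m by [].
congr (_ ++ (_ ++ _)).
  by rewrite !IH ?(leq_ltn_trans sL) ?(leq_trans sL).
by rewrite !IH ?(leq_ltn_trans sR) ?(leq_trans sR).
Qed.

Lemma stack_sort0 : stack_sort [::] = [::].
Proof. by []. Qed.

Lemma stack_sort_cat (L R : seq nat) (n : nat) :
  all (fun x => x < n) L -> all (fun x => x < n) R ->
  stack_sort (L ++ n :: R) = stack_sort L ++ stack_sort R ++ [:: n].
Proof.
move=> ltL ltR.
have maxE : \max_(x <- L ++ n :: R) x = n.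
  apply/eqP; rewrite eqn_leq; apply/andP; split.
    apply/bigmax_leqP_seq => x; rewrite mem_cat inE.
    by case/or3P=> [/(allP ltL)/ltnW|/eqP->|/(allP ltR)/ltnW].
  by apply: (@leq_bigmax_seq _ _ predT (fun x => x)); rewrite // mem_cat mem_head orbT.
have nL : n \notin L by apply/negP => /(allP ltL); rewrite ltnn.
have iE : index n (L ++ n :: R) = size L.
  by rewrite index_cat (negPf nL) /= eqxx addn0.
rewrite {1}/stack_sort size_cat /= addnS /=.
case E : (L ++ n :: R) => [|a w]; first by case: (L) E.
rewrite -E maxE iE take_size_cat //.
have -> : drop (size L).+1 (L ++ n :: R) = R.
  by rewrite -cat_rcons drop_size_cat // size_rcons.
by rewrite !stack_sort_rec_fuel ?leq_addr ?leq_addl.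
Qed.

Definition uniquely_sorted (p : seq nat) : Prop :=
  exists! w : seq nat, is_permutation w /\ stack_sort w = p.

(** * Pattern avoidance *)

Definition same_relative_order (u v : seq nat) : Prop :=
  size u = size v /\
  forall i j : nat, i < size u -> j < size u ->
    (nth 0 u i < nth 0 u j) = (nth 0 v i < nth 0 v j).

Definition avoids (p tau : seq nat) : Prop :=
  ~ exists2 t : seq nat, subseq t p & same_relative_order t tau.

Definition U (n : nat) (tau1 tau2 : seq nat) : set (seq nat) :=
  [set p | [/\ perm_eq p (iota 1 n), uniquely_sorted p,
               avoids p tau1 & avoids p tau2]]%classic.

(** * Noncrossing partitions *)

(* The ground set [k] is represented by ['I_k], i.e. shifted to {0, .., k-1}. *)
Definition noncrossing (k : nat) (P : {set {set 'I_k}}) : bool :=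
  [forall B in P, forall B' in P, (B != B') ==>
    [forall a in B, forall b in B', forall c in B, forall d in B',
      ~~ [&& a < b, b < c & c < d]]].

Definition is_NC (k : nat) (P : {set {set 'I_k}}) : bool :=
  partition P [set: 'I_k] && noncrossing P.

Record NC (k : nat) := MkNC {
  NC_blocks :> {set {set 'I_k}};
  NC_prop : is_NC NC_blocks }.

HB.instance Definition _ (k : nat) := [isSub for @NC_blocks k].
HB.instance Definition _ (k : nat) := [Countable of NC k by <:].
HB.instance Definition _ (k : nat) := [Finite of NC k by <:].

Section Refinement.
Variable k : nat.
Implicit Types x y z : NC k.

Definition refines x y : bool :=
  [forall B in NC_blocks x, exists C in NC_blocks y, B \subset C].

Lemma refinesP x y :
  reflect (forall B, B \in NC_blocks x ->
             exists2 C, C \in NC_blocks y & B \subset C)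
          (refines x y).
Proof.
apply: (iffP forall_inP) => H B xB; first by have /exists_inP := H B xB.
by apply/exists_inP; apply: H.
Qed.

Fact refines_refl : reflexive refines.
Proof. by move=> x; apply/refinesP => B xB; exists B. Qed.

Fact refines_trans : transitive refines.
Proof.
move=> y x z /refinesP xy /refinesP yz; apply/refinesP => B /xy[C /yz[D zD CD] BC].
by exists D => //; apply: subset_trans CD.
Qed.

Fact refines_anti : antisymmetric refines.
Proof.
have sub x y : refines x y -> refines y x -> NC_blocks x \subset NC_blocks y.
  move=> /refinesP xy /refinesP yx; apply/subsetP => B xB.
  have [C yC BC] := xy B xB; have [B' xB' CB'] := yx C yC.
  have /andP[/and3P[_ /trivIsetP tx x0] _] := NC_prop x.
  have [E|/(tx _ _ xB xB')] := eqVneq B B'.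
    by rewrite -E in CB'; suff -> : B = C by []; apply/eqP; rewrite eqEsubset BC.
  rewrite -setI_eq0 (setIidPl (subset_trans BC CB')) => /eqP B0.
  by rewrite B0 (negPf x0) in xB.
move=> x y /andP[xy yx]; apply/val_inj/eqP.
by rewrite eqEsubset !sub.
Qed.

End Refinement.

Fact NC_display : Order.disp_t. Proof. exact: Order.Disp tt tt. Qed.

HB.instance Definition _ (k : nat) :=
  Order.Le_isPOrder.Build NC_display (NC k)
    (@refines_refl k) (@refines_anti k) (@refines_trans k).

Lemma NC_leE (k : nat) (x y : NC k) : (x <= y)%O = refines x y.
Proof. by []. Qed.

Definition Int (d : Order.disp_t) (P : porderType d) : set (P * P) :=
  [set xy | (xy.1 <= xy.2)%O]%classic.

Arguments Int {d} P.

(* Main.v *)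
Require Import Defs.
From mathcomp Require Import boolp classical_sets functions.
From mathcomp Require Import all_boot all_order zify.

Set Implicit Arguments.
Unset Strict Implicit.
Unset Printing Implicit Defensive.

(** Both sides are put in bijection with the ternary trees with [k] nodes.

    Stack-sorting turns the inorder word of a decreasing binary tree into its
    postorder word, so a word is uniquely sorted if it is the postorder word of
    exactly one decreasing tree. This forces the nodes to have zero or two
    children and every leaf but the first to be the bottom of a descent; for a
    word avoiding 312 it then amounts to a ballot condition on descents and
    ascents. A permutation avoiding 312 and 1342 with first letter [G + 1]
    consists of the letters [G, .., 1] in decreasing order interleaved with
    increasing layers of larger letters; recording layer sizes and numbers of
    small letters gives a sequence of pairs for which the ballot condition is
    the Lukasiewicz condition, i.e. the preorder code of a plane forest in which
    every list of children is cut in two.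

    For an interval [rho <= kappa] of noncrossing partitions, let [i <= j] be
    the maxima of the blocks of [0] in [rho] and in [kappa]. Restricting to
    [1 .. i], [i + 1 .. j] and [j + 1 ..] yields three arbitrary intervals of
    noncrossing partitions that determine the given one. *)

(** * Uniquely sorted permutations *)

Inductive bintree := Leaf | Node of bintree & nat & bintree.

Fixpoint inorder t :=
  if t is Node l x r then inorder l ++ x :: inorder r else [::].

Fixpoint postorder t :=
  if t is Node l x r then postorder l ++ postorder r ++ [:: x] else [::].

Fixpoint decreasing t :=
  if t is Node l x r then
    [&& all (fun y => y < x) (postorder l), all (fun y => y < x) (postorder r),
        decreasing l & decreasing r]
  else true.

Definition is_leaf t := if t is Leaf then true else false.

Lemma perm_inorder t : perm_eq (inorder t) (postorder t).
Proof.
elim: t => //= l IHl x r IHr.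
by rewrite perm_cat // -cat1s perm_catC perm_cat2r.
Qed.

Lemma all_inorder a t : all a (inorder t) = all a (postorder t).
Proof. exact/perm_all/perm_inorder. Qed.

Lemma stack_sort_inorder t : decreasing t -> stack_sort (inorder t) = postorder t.
Proof.
elim: t => //= l IHl x r IHr /and4P[ltl ltr dl dr].
by rewrite stack_sort_cat ?all_inorder // IHl ?IHr.
Qed.

Lemma inorder_surj (w : seq nat) : uniq w -> exists2 t, decreasing t & inorder t = w.
Proof.
have [n] := ubnP (size w); elim: n w => // n IH w lewn uw.
have [->|w0] := eqVneq w [::]; first by exists Leaf.
have mw := bigmax_mem w0; set m := \max_(x <- w) x in mw.
have lem x : x \in w -> x <= m.
  by move=> xw; apply: (@leq_bigmax_seq _ _ predT (fun x => x)).
have [L [R wE]] : exists L R, w = L ++ m :: R by case/splitPr: mw => L R; exists L, R.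
clearbody m; subst w => {w0 mw}.
move: uw; rewrite cat_uniq /= => /and4P[uL /norP[mL _] mR uR].
have szE : size (L ++ m :: R) = (size L + size R).+1 by rewrite size_cat /= addnS.
have [l dl lE] := IH L ltac:(lia) uL.
have [r dr rE] := IH R ltac:(lia) uR.
exists (Node l m r); rewrite /= ?lE ?rE // dl dr -!all_inorder lE rE !andbT.
apply/andP; split; apply/allP => x xX;
  rewrite ltn_neqAle lem ?mem_cat ?inE ?xX ?orbT // andbT.
  by apply: contraNneq mL => <-.
by apply: contraNneq mR => <-.
Qed.

(** The root is the largest letter of the word and occurs only once, so its position splits the word
    between the two subtrees. *)
Lemma inorder_inj t t' :
  decreasing t -> decreasing t' -> inorder t = inorder t' -> t = t'.
Proof.
elim: t t' => [|l IHl x r IHr] [|l' x' r'] //=; try by case: inorder.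
move=> /and4P[ll lr dl dr] /and4P[ll' lr' dl' dr'] E.
have lt_max (s1 s2 : seq nat) y z : all (fun y => y < z) s1 -> all (fun y => y < z) s2 ->
    y \in s1 ++ z :: s2 -> y <= z.
  move=> a1 a2; rewrite mem_cat inE => /or3P[/(allP a1)|/eqP->|/(allP a2)] //;
    exact: ltnW.
rewrite -!all_inorder in ll lr ll' lr'.
have xx : x = x'.
  apply/eqP; rewrite eqn_leq (lt_max _ _ x x' ll' lr') -?E ?mem_cat ?mem_head ?orbT //.
  by rewrite (lt_max _ _ x' x ll lr) // E mem_cat mem_head orbT.
rewrite -{}xx in E ll' lr' *.
have nl : x \notin inorder l by apply/negP => /(allP ll); rewrite ltnn.
have nl' : x \notin inorder l' by apply/negP => /(allP ll'); rewrite ltnn.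
have /eqP := E; rewrite eqseq_cat.
  by case/andP=> /eqP/(IHl _ dl dl')-> /eqP[/(IHr _ dr dr')->].
have := congr1 (index x) E.
by rewrite !index_cat (negPf nl) (negPf nl') /= eqxx !addn0.
Qed.

(** By the preceding lemmas [inorder] is a bijection from decreasing trees to words with distinct
    letters, and under it [stack_sort] becomes [postorder]. *)
Lemma uniquely_sortedP p : is_permutation p ->
  uniquely_sorted p <-> exists! t, decreasing t /\ postorder t = p.
Proof.
move=> pp.
have perm t : postorder t = p -> is_permutation (inorder t).
  by move=> pt; rewrite /is_permutation (perm_uniq (perm_inorder t)) all_inorder pt.
split=> [[w [[/andP[uw _] sw] uniqw]]|[t [[dt pt] uniqt]]].
  have [t dt tE] := inorder_surj uw; exists t; split=> [|t' [dt' pt']].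
    by rewrite -sw -tE stack_sort_inorder.
  apply: inorder_inj => //; rewrite tE; apply: uniqw.
  by split; [apply: perm | rewrite stack_sort_inorder].
exists (inorder t); split=> [|w [/andP[uw _]]].
  by split; [apply: perm | rewrite stack_sort_inorder].
have [t' dt' <-] := inorder_surj uw.
by rewrite stack_sort_inorder // => pt'; rewrite (uniqt t').
Qed.

(* A tree all of whose nodes have zero or two children, such that in the
   postorder word a leaf that is not the first letter is preceded by a larger
   letter; [head 0 (postorder r)] is the first leaf of [r]. *)
Fixpoint canonical t :=
  if t is Node l x r then
    is_leaf l && is_leaf r ||
    [&& canonical l, canonical r & head 0 (postorder r) < last 0 (postorder l)]
  else false.

Lemma postorder_neq0 t : ~~ is_leaf t -> postorder t != [::].
Proof. by case: t => //= l x r _; rewrite -size_eq0 !size_cat /= !addnS. Qed.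

Lemma last_postorder l x r z : last z (postorder (Node l x r)) = x.
Proof. by rewrite /= !last_cat. Qed.

Lemma canonical_leaf t : canonical t -> ~~ is_leaf t. Proof. by case: t. Qed.

Lemma head_postorder_mem t : ~~ is_leaf t -> head 0 (postorder t) \in postorder t.
Proof. by move/postorder_neq0; case: postorder => // a s _; rewrite mem_head. Qed.

Lemma last_irr (x y : nat) s : s != [::] -> last x s = last y s.
Proof. by case: s. Qed.

Lemma head_cat (x : nat) s1 s2 : s1 != [::] -> head x (s1 ++ s2) = head x s1.
Proof. by case: s1. Qed.

Lemma postorder_le_last t y : decreasing t -> y \in postorder t ->
  y <= last 0 (postorder t).
Proof.
case: t => // l x r /= /and4P[ll lr _ _]; rewrite !last_cat /= !mem_cat inE.
by case/or3P=> [/(allP ll)/ltnW|/(allP lr)/ltnW|/eqP->].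
Qed.

(** In a canonical tree the bottom of the left spine has no children; [l] becomes its left subtree,
    and the dropped [t2] is a [Leaf]. *)
Fixpoint graft l t :=
  if t is Node t1 y t2 then
    if is_leaf t1 then Node l y Leaf else Node (graft l t1) y t2
  else Leaf.

Lemma postorder_graft l t : canonical t -> postorder (graft l t) =
  postorder l ++ postorder t.
Proof.
elim: t => //= t1 IH1 y t2 _.
case: t1 IH1 => [|t11 z t12] IH1 /= h; first by case: t2 h.
by rewrite -[_ || _]/(canonical (Node t11 z t12)) /= in h *;
  case/and3P: h => /IH1 -> _ _; rewrite !catA.
Qed.

Lemma decreasing_graft l t : canonical t -> decreasing l -> decreasing t ->
  all (fun y => y < head 0 (postorder t)) (postorder l) -> decreasing (graft l t).
Proof.
move=> ct dl; elim: t ct => //= t1 IH1 y t2 _.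
case E: (is_leaf t1) => /=.
  by case: t1 E IH1 => // _ IH1; case: t2 => //= _ _ al; rewrite al dl.
move=> /and3P[c1 c2 _] /and4P[l1 l2 d1 d2].
rewrite head_cat ?postorder_neq0 ?E // => al.
rewrite (IH1 c1 d1 al) l2 d2 postorder_graft // all_cat l1 !andbT /=.
apply/allP => z /(allP al) /ltn_trans; apply.
by apply: (allP l1); rewrite head_postorder_mem ?E.
Qed.

(* A tree that is not canonical has a node with one child, which can be moved
   to the other side, or a node whose left subtree can be grafted below the
   first leaf of its right subtree; neither changes the postorder word. *)
Lemma not_canonical t : decreasing t -> uniq (postorder t) -> ~~ is_leaf t ->
  ~~ canonical t ->
  exists t', [/\ decreasing t', postorder t' = postorder t & t' <> t].
Proof.
elim: t => // l IHl x r IHr /= /and4P[ll lr dl dr].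
rewrite !cat_uniq => /and3P[ul /hasPn dlr /andP[ur _]] _.
case El: (is_leaf l).
  case: l El {IHl dlr ul dl ll} => //= _; case: r lr dr {IHr ur} => //= r1 z r2 lr dr _.
  by exists (Node (Node r1 z r2) x Leaf); split=> //=; rewrite lr dr.
case Er: (is_leaf r) => /=.
  case: r Er {IHr dlr ur lr dr} => //= _ _; exists (Node Leaf x l); split=> //=.
    by rewrite ll dl.
  by move=> E; case: E El => <-.
rewrite !negb_and => /or3P[nl|nr|].
- have [l' [dl' pl' nE]] := IHl dl ul (negbT El) nl; exists (Node l' x r).
  by rewrite /= pl' ll lr dl' dr; split=> // -[].
- have [r' [dr' pr' nE]] := IHr dr ur (negbT Er) nr; exists (Node l x r').
  by rewrite /= pr' ll lr dr' dl; split=> // -[].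
have [cr|nr _] := boolP (canonical r); last first.
  have [r' [dr' pr' nE]] := IHr dr ur (negbT Er) nr; exists (Node l x r').
  by rewrite /= pr' ll lr dr' dl; split=> // -[].
(* All letters of [l] are at most its last letter, hence smaller than the first letter of [r]:
   equality is excluded because letters are distinct. *)
rewrite -leqNgt => le_lr; exists (Node Leaf x (graft l r)).
rewrite /= postorder_graft // all_cat ll lr decreasing_graft //.
  by split=> //; [rewrite catA | case=> E; rewrite -E in El].
apply/allP => y yl;
  rewrite (leq_ltn_trans (postorder_le_last dl yl)) // ltn_neqAle le_lr andbT.
apply/eqP => E; have := dlr (head 0 (postorder r)).
rewrite -E mem_cat {1}E head_postorder_mem ?Er // => /(_ isT)/negP; apply.
by case: l El {IHl dl ll ul le_lr dlr yl E} => // l1 z l2 _;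
  rewrite last_postorder !mem_cat inE eqxx !orbT.
Qed.

(** * Descents, and uniqueness of the canonical tree of a word *)

Fixpoint descents x (s : seq nat) :=
  if s is y :: s' then (y < x) + descents y s' else 0.

Lemma descents_cat x s1 s2 :
  descents x (s1 ++ s2) = descents x s1 + descents (last x s1) s2.
Proof. by elim: s1 x => //= y s IH x; rewrite IH addnA. Qed.

Lemma descents_rcons x s y : all (fun z => z < y) s -> descents x (s ++ [:: y]) =
  descents x s + (nilp s && (y < x)).
Proof.
elim: s x => /= [|z s IH] x; first by rewrite addn0.
by case/andP=> zy /IH->; rewrite (ltnNge y z) (ltnW zy) andbF !addn0.
Qed.

(** Descents end at leaves, since an inner node follows a smaller letter, and a tree with [n] nodes
    has at most [(n + 1) / 2] leaves, with equality when all nodes have zero or two children. The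
    bound depends only on the word, hence so does being canonical. The letter before the word is
    [x]. *)
Lemma descents_postorder x t : decreasing t -> ~~ is_leaf t ->
  (2 * descents x (postorder t)).+1 <= size (postorder t) + 2 * (head 0 (postorder t) < x)
     ?= iff canonical t.
Proof.
elim: t x => // l IHl z r IHr x /= /and4P[ll lr dl dr] _.
rewrite catA descents_rcons ?all_cat ?ll // descents_cat !size_cat /=.
have [El|El] := boolP (is_leaf l).
  case: l El {IHl ll dl} => //= _.
  have [Er|Er] := boolP (is_leaf r).
    by case: r Er {IHr lr dr} => //= _; split; lia.
  have r0 := postorder_neq0 Er.
  rewrite head_cat // (_ : nilp (postorder r) = false) /=;
    last by rewrite /nilp size_eq0 (negPf r0).
  have [h _] := IHr x dr Er; split; first by lia.
  by apply/eqP; lia.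
have l0 := postorder_neq0 El; have [hl el] := IHl x dl El.
rewrite -catA head_cat // (_ : nilp (_ ++ _) = false) /=; last first.
  by rewrite /nilp size_cat addn_eq0; move: l0; rewrite -size_eq0 => /negbTE->.
have [Er|Er] := boolP (is_leaf r).
  case: r Er {IHr lr dr} => //= _; split; first by lia.
  by rewrite andbF; apply/eqP; lia.
have [hr er] := IHr (last x (postorder l)) dr Er.
rewrite (last_irr x 0 l0) in hr er *.
by split; [lia | rewrite -el -er; case: (_ < last _ _) hr => /= hr; lia].
Qed.

(** Parses a postorder word: the bottom of a descent is a new leaf, any other letter joins the two
    top trees. The previous letter is [x]; the empty stack in the last branch signals failure. *)
Fixpoint shift_reduce (S : seq bintree) x (s : seq nat) : seq bintree :=
  if s is y :: s' then
    if y < x then shift_reduce (Node Leaf y Leaf :: S) y s' else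
    if S is r :: l :: S' then shift_reduce (Node l y r :: S') y s' else [::]
  else S.

Lemma shift_reduce_postorder S x t s : canonical t -> decreasing t ->
  head 0 (postorder t) < x ->
  shift_reduce S x (postorder t ++ s) = shift_reduce (t :: S) (last 0 (postorder t)) s.
Proof.
elim: t S x s => //= l IHl y r IHr S x s.
case El: (is_leaf l).
  by case: l El {IHl} => //= _; case: r {IHr} => //= _ _ ->.
move=> /= /and3P[cl cr hr] /and4P[ll lr dl dr].
have l0 := postorder_neq0 (negbT El); have r0 := postorder_neq0 (canonical_leaf cr).
rewrite head_cat // => lx; rewrite !last_cat /= -!catA IHl // IHr //=.
rewrite ifN // -leqNgt ltnW //; apply: (allP lr).
by case: (postorder r) r0 => //= a q _; apply: mem_last.
Qed.

Lemma canonical_inj t t' : canonical t -> canonical t' ->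
  decreasing t -> decreasing t' -> postorder t = postorder t' -> t = t'.
Proof.
(* With this [x], the first letter counts as the bottom of a descent and is pushed as a leaf. *)
move=> ct ct' dt dt' E; set x := (head 0 (postorder t)).+1.
have := shift_reduce_postorder [::] [::] ct dt (leqnn x).
by rewrite E shift_reduce_postorder // -?E // => -[->].
Qed.

(** A unique tree is canonical by [not_canonical]. Conversely, if one tree of [p] is canonical then
    so are all, by the equality case of [descents_postorder], and parsing shows that they
    coincide. *)
Lemma uniquely_sorted_canonical p : is_permutation p -> p != [::] ->
  uniquely_sorted p <-> exists t, [/\ canonical t, decreasing t & postorder t = p].
Proof.
move=> pp p0; rewrite uniquely_sortedP //.
have nl t : postorder t = p -> ~~ is_leaf t by move=> E; case: t E p0 => //= <-.
split=> [[t [[dt pt] uniqt]]|[t [ct dt pt]]].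
  exists t; split=> //; apply/negPn/negP => nct.
  have [|t' [dt' pt' nE]] := not_canonical dt _ (nl _ pt) nct.
    by rewrite pt; case/andP: pp.
  by apply/nE/esym/uniqt; rewrite dt' pt'.
exists t; split=> // t' [dt' pt'].
apply: canonical_inj; rewrite ?pt' //.
have [_ <-] := descents_postorder 0 dt' (nl _ pt').
have [_] := descents_postorder 0 dt (nl _ pt).
by rewrite ct pt pt' => ->.
Qed.

(** * Pattern avoidance *)

Lemma avoids312P p : avoids p [:: 3; 1; 2] <->
  forall a b c, subseq [:: a; b; c] p -> ~~ (b < c < a).
Proof.
split=> [H a b c sp|H [t tp [st rel]]].
  apply/negP => /andP[bc ca]; apply: H; exists [:: a; b; c] => //; split=> //.
  by case=> [|[|[|i]]] [|[|[|j]]] //= *; lia.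
case: t st tp rel => [|a [|b [|c []]]] // _ /H/negP h rel; apply: h.
by rewrite (rel 1 2) // (rel 2 0).
Qed.

Lemma avoids1342P p : avoids p [:: 1; 3; 4; 2] <->
  forall a b c d, subseq [:: a; b; c; d] p -> ~~ [&& a < d, d < b & b < c].
Proof.
split=> [H a b c d sp|H [t tp [st rel]]].
  apply/negP => /and3P[ad db bc]; apply: H; exists [:: a; b; c; d] => //; split=> //.
  by case=> [|[|[|[|i]]]] [|[|[|[|j]]]] //= *; lia.
case: t st tp rel => [|a [|b [|c [|d []]]]] // _ /H/negP h rel; apply: h.
by rewrite (rel 0 3) // (rel 3 1) // (rel 1 2).
Qed.

(* [c] is the size of the stack of subtrees when the tree with postorder word
   [s] is rebuilt as in [shift_reduce]. *)
Fixpoint balanced c x (s : seq nat) :=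
  if s is y :: s' then
    if y < x then balanced c.+1 y s' else (1 < c) && balanced c.-1 y s'
  else c == 1.

Lemma balanced_postorder c x t s : canonical t -> decreasing t ->
  head 0 (postorder t) < x ->
  balanced c x (postorder t ++ s) = balanced c.+1 (last 0 (postorder t)) s.
Proof.
elim: t c x s => //= l IHl y r IHr c x s.
case El: (is_leaf l).
  by case: l El {IHl} => //= _; case: r {IHr} => //= _ _ ->.
move=> /= /and3P[cl cr hr] /and4P[ll lr dl dr].
have l0 := postorder_neq0 (negbT El); have r0 := postorder_neq0 (canonical_leaf cr).
rewrite head_cat // => lx; rewrite !last_cat /= -!catA IHl // IHr //=.
rewrite ifN // -leqNgt ltnW //; apply: (allP lr).
by case: (postorder r) r0 => //= a q _; apply: mem_last.
Qed.

Fixpoint stack_word (S : seq bintree) : seq nat :=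
  if S is t :: S' then stack_word S' ++ postorder t else [::].

(** The last condition is the one that [canonical] imposes when [t] becomes the right subtree of a
    node whose left subtree is [u]. *)
Fixpoint stack_ok (S : seq bintree) : bool :=
  if S is t :: S' then
    [&& canonical t, decreasing t, stack_ok S' &
      if S' is u :: _ then head 0 (postorder t) < last 0 (postorder u) else true]
  else true.

(** The parser runs on the unread word [q]. A joining letter [y] exceeds the previous letter [v]; a
    larger letter [z] read earlier would make [z], [v], [y] a 312. So [y] exceeds everything read
    and the joined tree is decreasing. *)
Lemma balanced_canonical t S q : stack_ok (t :: S) ->
  uniq (stack_word (t :: S) ++ q) ->
  (forall a b c, subseq [:: a; b; c] (stack_word (t :: S) ++ q) -> ~~ (b < c < a)) ->
  balanced (size S).+1 (last 0 (postorder t)) q ->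
  exists t', [/\ canonical t', decreasing t' & postorder t' = stack_word (t :: S) ++ q].
Proof.
elim: q t S => [|y q IH] t S ok uq no312.
  by case: S ok {uq no312} => //= /and3P[ct dt _] _; exists t; rewrite cats0.
rewrite [balanced _ _ _]/=; case: ifP => [yt|/negbT yt].
  move=> bal; have := IH (Node Leaf y Leaf) (t :: S).
  rewrite /= -!catA /=; apply => //; first by move: ok => /= ->; rewrite yt.
    by move: uq => /=; rewrite -!catA.
  by move: no312 => /=; rewrite -!catA.
case: S ok uq no312 => [|u S] // ok uq no312 /= bal.
move: ok => /= /and4P[ct dt /and4P[cu du okS hu] ht].
have t0 := postorder_neq0 (canonical_leaf ct);
  have u0 := postorder_neq0 (canonical_leaf cu).
have lety z : z \in stack_word [:: t, u & S] -> z < y.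
  move=> zw; set v := last 0 (postorder t) in yt.
  have [w wE] : exists w, stack_word [:: t, u & S] = rcons w v.
    rewrite /v /=; case/lastP: (postorder t) t0 => // s b _.
    by rewrite last_rcons -rcons_cat; eexists.
  have yw : y \notin stack_word [:: t, u & S].
    by move: uq; rewrite cat_uniq /= => /and3P[_ /norP[]].
  have vw : v \in stack_word [:: t, u & S] by rewrite wE mem_rcons mem_head.
  have vy : v < y by rewrite ltn_neqAle leqNgt yt andbT; apply: contraNneq yw => <-.
  move: zw; rewrite wE mem_rcons inE => /predU1P[-> //|zw].
  have zy : z != y by apply: contraNneq yw => <-; rewrite wE mem_rcons inE zw orbT.
  rewrite ltn_neqAle zy leqNgt /=; apply/negP => yz.
  have := no312 z v y; rewrite vy yz => /(_ _)/negP; apply=> //.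
  by rewrite wE cat_rcons (@cat_subseq _ [:: z] [:: v; y]) ?sub1seq //= !eqxx sub0seq.
have := IH (Node u y t) S; rewrite /= -!catA /= => IH'; apply: IH'.
- rewrite ct cu ht dt du okS orbT /= head_cat //.
  have -> : all (fun z => z < y) (postorder u).
    by apply/allP => z zu; apply: lety; rewrite /= !mem_cat zu orbT.
  have -> //= : all (fun z => z < y) (postorder t).
  by apply/allP => z zu; apply: lety; rewrite /= !mem_cat zu orbT.
- by move: uq; rewrite /= -!catA.
- by move: no312; rewrite /= -!catA.
by rewrite !last_cat.
Qed.

Lemma uniquely_sorted_balanced p : is_permutation p -> p != [::] ->
  avoids p [:: 3; 1; 2] ->
  uniquely_sorted p <-> balanced 0 (head 0 p).+1 p.
Proof.
move=> pp p0 /avoids312P no312; rewrite uniquely_sorted_canonical //.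
split=> [[t [ct dt pt]]|].
  by rewrite -pt -[X in balanced _ _ X]cats0 balanced_postorder.
case: p p0 pp no312 => //= x q _ /andP[uq _] no312; rewrite leqnn => bal.
exact: (@balanced_canonical (Node Leaf x Leaf) [::] q).
Qed.

Lemma subseq_catP (t s1 s2 : seq nat) : subseq t (s1 ++ s2) ->
  exists t1 t2, [/\ t = t1 ++ t2, subseq t1 s1 & subseq t2 s2].
Proof.
elim: s1 t => [|x s1 IH] t /=; first by exists [::], t.
case: t => [|y t]; first by exists [::], [::]; rewrite sub0seq.
case: eqP => [->|_] /IH[t1 [t2 [tE sub1 sub2]]].
  by exists (x :: t1), t2; rewrite tE /= eqxx.
exists t1, t2; split=> //; exact: subseq_trans (subseq_cons _ _).
Qed.

Lemma pairwise_subseq2 (r : rel nat) (s : seq nat) :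
  (forall a b : nat, subseq [:: a; b] s -> r a b) -> pairwise r s.
Proof.
elim: s => //= x s IH rs; apply/andP; split.
  by apply/allP => y ys; apply: rs; rewrite eqxx sub1seq.
by apply: IH => a b ab; apply: rs; apply: subseq_trans ab (subseq_cons s x).
Qed.

(** * Permutations avoiding 312 and 1342 as layered words *)

Definition down a n := rev (iota a.+1 n).

Lemma down0 a : down a 0 = [::]. Proof. by []. Qed.

Lemma downS a n : down a n.+1 = a + n.+1 :: down a n.
Proof. by rewrite /down -[n.+1]addn1 iotaD rev_cat /= addSn addn1 addnS. Qed.

Lemma size_down a n : size (down a n) = n.
Proof. by rewrite size_rev size_iota. Qed.

Lemma mem_down a n x : (x \in down a n) = (a < x <= a + n).
Proof. by rewrite mem_rev mem_iota addSn. Qed.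

Lemma pairwise_down a n : pairwise (fun x y => y < x) (down a n).
Proof.
elim: n => // n IH; rewrite downS /= IH andbT.
by apply/allP => x; rewrite mem_down addnS ltnS => /andP[].
Qed.

(* The letters at most [G] appear in decreasing order, interleaved with the
   letters above [M], which form increasing layers: each pair [(g, h)] of [w]
   contributes a layer of [g + 1] consecutive letters and then [h] small ones. *)
Fixpoint layered G M (w : seq (nat * nat)) :=
  if w is (g, h) :: w' then
    (down M g.+1 ++ down (G - h) h) ++ layered (G - h) (M + g.+1) w'
  else [::].

Definition small (w : seq (nat * nat)) := sumn (unzip2 w).
Definition large (w : seq (nat * nat)) := sumn (unzip1 w) + size w.

Lemma small_cons g h w : small ((g, h) :: w) = h + small w. Proof. by []. Qed.

Lemma large_cons g h w : large ((g, h) :: w) = g.+1 + large w.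
Proof. by rewrite /large /=; lia. Qed.

Lemma perm_layered G M w : small w = G ->
  perm_eq (layered G M w) (iota 1 G ++ iota M.+1 (large w)).
Proof.
elim: w G M => [|[g h] w IH] G M /=; first by move=> <-.
rewrite small_cons large_cons => <-; rewrite addnC addnK.
have {IH} IH := IH _ (M + g.+1) (erefl (small w)).
rewrite (iotaD 1) (iotaD M.+1 g.+1) add1n addSn.
by apply/permP => a; rewrite !count_cat !count_rev (permP IH) !count_cat; lia.
Qed.

Lemma mem_layered G M w x : small w = G ->
  (x \in layered G M w) = (0 < x <= G) || (M < x <= M + large w).
Proof. by move/perm_layered/perm_mem->; rewrite mem_cat !mem_iota add1n addSn. Qed.

Lemma pairwise_step G M g h : h <= G -> G <= M ->
  pairwise (fun x y => y < x) (down M g.+1 ++ down (G - h) h).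
Proof.
move=> hG GM; rewrite pairwise_cat !pairwise_down !andbT.
by apply/allrelP => x y; rewrite !mem_down; lia.
Qed.

Lemma pairwise_layered G M w : small w = G -> G <= M ->
  pairwise (fun b c => (c <= G) ==> (c < b)) (layered G M w).
Proof.
elim: w G M => [|[g h] w IH] G M //=; rewrite small_cons => wG GM.
have hG : h <= G by lia.
rewrite pairwise_cat; apply/and3P; split.
- apply/allrelP => x y; rewrite mem_cat !mem_down mem_layered; last by lia.
  by move=> *; apply/implyP; lia.
- apply: sub_pairwise (pairwise_step _ hG GM) => x y yx.
  by rewrite yx implybT.
have wG' : small w = G - h by lia.
have GM' : G - h <= M + g.+1 by lia.
apply: sub_in_pairwise (allss _) (IH _ _ wG' GM') => x y _.
rewrite -topredE /= mem_layered // => yG /implyP xy; apply/implyP; lia.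
Qed.

(** Each layer with the small letters after it is decreasing. If [c] comes in a later such step than
    [a], it is either larger than [a], or small and then below every letter before it. *)
Lemma layered_no312 G M w a b c : small w = G -> G <= M ->
  subseq [:: a; b; c] (layered G M w) -> ~~ (b < c < a).
Proof.
elim: w G M => [|[g h] w IH] G M //; rewrite small_cons => wG GM sub.
have hG : h <= G by lia.
have wG' : small w = G - h by lia.
have P := pairwise_layered (w := (g, h) :: w) wG GM.
have /= := subseq_pairwise sub P => /and3P[_ /andP[bc _] _].
move: sub => /= /subseq_catP[t1 [t2 [tE s1 s2]]].
case: t1 tE s1 => [|a' t1] /= tE s1; first by apply: (IH _ (M + g.+1) wG');
  rewrite ?tE //; lia.
case: tE => E tE; rewrite -{}E in s1 => {a'}.
have am : a \in down M g.+1 ++ down (G - h) h by apply: (mem_subseq s1); rewrite mem_head.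
have cm : c \in t1 ++ t2 by rewrite -tE !inE eqxx orbT.
apply/negP => /andP[lbc lca].
move: cm; rewrite mem_cat => /orP[ct1|ct2]; last first.
  have := mem_subseq s2 ct2; rewrite mem_layered //.
  by move: am bc; rewrite mem_cat !mem_down; lia.
case: t1 tE s1 ct1 => [|b' [|c' t1]] //=; first by case=> <- _ _; rewrite inE; lia.
case=> <- <- _ s1 _.
have := subseq_pairwise s1 (pairwise_step _ hG GM).
by move=> /= /and3P[_ /andP[]]; lia.
Qed.

(** A step is decreasing, so [b], and hence [c], lies in a later step than [a], where letters are
    either small or larger than [a]. *)
Lemma layered_no231 G M w a b c : small w = G -> G <= M ->
  subseq [:: a; b; c] (layered G M w) -> c < a < b -> c <= G.
Proof.
elim: w G M => [|[g h] w IH] G M //;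
  rewrite small_cons => wG GM /subseq_catP[t1 [t2 [tE s1 s2]]] cab.
have hG : h <= G by lia.
have wG' : small w = G - h by lia.
have GM' : G - h <= M + g.+1 by lia.
have IH' := IH _ (M + g.+1) wG' GM'.
have P := pairwise_step g hG GM.
case: t1 tE s1 => [|a' t1] /= tE s1.
  by rewrite -tE in s2; have := IH' s2 cab; lia.
case: tE => E tE; rewrite -{}E in s1 => {a'}.
have am : a \in down M g.+1 ++ down (G - h) h by apply: (mem_subseq s1); rewrite mem_head.
have bm : b \notin t1.
  apply/negP => /(allP _)/=; have /andP[h1 _] := subseq_pairwise s1 P.
  by move/(_ _ h1); lia.
have cm : c \in t1 ++ t2 by rewrite -tE !inE eqxx orbT.
case: t1 tE s1 bm cm => [|b' t1] /= tE s1 bm cm; last by move: tE bm => [->];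
  rewrite mem_head.
have := mem_subseq s2 cm; rewrite mem_layered //.
by move: am; rewrite mem_cat !mem_down; lia.
Qed.

(** Here [r] counts the vertices announced but not yet read; a pair [(g, h)] is a vertex with
    [g + h] children. *)
Fixpoint lukasiewicz r (w : seq (nat * nat)) :=
  if w is (g, h) :: w' then (0 < r) && lukasiewicz (r.-1 + (g + h)) w' else r == 0.

Lemma balanced_cat c x s q : pairwise (fun y z => z < y) (x :: s) ->
  balanced c x (s ++ q) = balanced (c + size s) (last x s) q.
Proof.
elim: s c x => [|y s IH] c x; first by rewrite addn0.
by case/andP=> /= /andP[-> _] /IH->; rewrite addSnnS.
Qed.

(** The first letter of a step is an ascent and joins two trees; the other [g + h] letters are
    bottoms of descents. The stack size is thus always one more than the Lukasiewicz count. *)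
Lemma balanced_layered G M w r x : small w = G -> G <= M -> x <= M ->
  balanced r.+1 x (layered G M w) = lukasiewicz r w.
Proof.
elim: w G M r x => [|[g h] w IH] G M r x //; rewrite small_cons => wG GM xM.
have hG : h <= G by lia.
have P := pairwise_step g hG GM.
rewrite [layered _ _ _]/= [lukasiewicz _ _]/=; move: P; rewrite downS cat_cons => P.
rewrite [LHS]/= ifN; last by lia.
case: r => //= r; rewrite balanced_cat // size_cat !size_down addSn.
have wG' : small w = G - h by lia.
apply: IH => //; first by lia.
have := mem_last (M + g.+1) (down M g ++ down (G - h) h).
move: (last _ _) => z; rewrite inE => /predU1P[->|]; first exact: leqnn.
by rewrite mem_cat !mem_down; lia.
Qed.

Lemma down_prefix M g (q : seq nat) : uniq q ->
  (forall y : nat, M < y <= M + g -> y \in q) ->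
  (forall a b : nat, subseq [:: a; b] q -> M < b <= M + g -> b < a <= M + g) ->
  exists q', q = down M g ++ q'.
Proof.
elim: g q => [|g IH] q uq inq subq; first by exists q.
have mq : M + g.+1 \in q by apply: inq; lia.
case: q uq inq subq mq => //= z q /andP[zq uq] inq subq; rewrite inE => zE.
have {zE} zE : z = M + g.+1.
  case/predU1P: zE => // zE.
  by have := subq z (M + g.+1); rewrite eqxx sub1seq zE => /(_ isT); lia.
have [|a b|q' qE] := IH q uq.
- move=> y yM; have := inq y; rewrite inE; case: eqP => [|_]; first by lia.
  by apply; lia.
- move=> ab bM; have := subq a b; case: (a =P z) => [aE|aE].
    by have := mem_subseq ab (mem_head _ _); rewrite aE (negPf zq).
  by rewrite ab => /(_ isT); lia.
by exists q'; rewrite downS -zE qE.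
Qed.

Lemma layered_surj N (q : seq nat) G M : uniq q -> G <= M -> M <= N ->
  (forall x : nat, (x \in q) = (0 < x <= G) || (M < x <= N)) ->
  pairwise (fun b c => (c <= G) ==> (c < b)) q ->
  (forall a b c : nat, subseq [:: a; b; c] q -> ~~ (b < c < a)) ->
  (forall a b c : nat, subseq [:: a; b; c] q -> M < c -> ~~ (c < a < b)) ->
  exists h w, h + small w = G /\ q = down (G - h) h ++ layered (G - h) M w.
Proof.
have [n] := ubnP (size q); elim: n q G M => // n IH [|x q] G M.
  move=> _ _ GM MN memq _ _ _; exists 0, [::]; split=> //.
  by have := memq G; rewrite in_nil /small /=; lia.
rewrite ltnS => len uxq GM MN memq dec no312 no231.
have := uxq; rewrite cons_uniq => /andP[xq uq].
have memq' y : (y \in q) = (y != x) && ((0 < y <= G) || (M < y <= N)).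
  by rewrite -memq inE; case: eqP => // ->; rewrite (negPf xq).
have sub3 a b c : subseq [:: a; b; c] q -> subseq [:: a; b; c] (x :: q).
  by move=> h; apply: subseq_trans h (subseq_cons _ _).
have := memq x; rewrite mem_head => /esym/orP[xG|xM].
  have xE : x = G.
    apply/eqP/negPn/negP => xE; move: dec => /= /andP[/allP/(_ G)].
    rewrite memq' eq_sym xE leqnn; lia.
  have [||||||h [w [wG qE]]] := IH q G.-1 M len uq; try by [lia].
  - by move=> y; rewrite memq' xE; lia.
  - move: dec => /= /andP[_]; apply: sub_pairwise => b c /implyP bc.
    by apply/implyP; lia.
  - by move=> a b c /sub3; apply: no312.
  - by move=> a b c /sub3; apply: no231.
  exists h.+1, w; split; first by lia.
  have -> : G - h.+1 = G.-1 - h by lia.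
  by rewrite downS qE cat_cons xE; congr (_ :: _); lia.
pose g := x - M.+1; have xE : x = M + g.+1 by rewrite /g; lia.
have [||q' qE] := @down_prefix M g q uq.
- by move=> y yM; rewrite memq'; lia.
- move=> a b ab bM.
  have aq : a \in q by apply: (mem_subseq ab); rewrite mem_head.
  have := no312 x a b; have := no231 x a b; rewrite /= eqxx => /(_ ab) h1 /(_ ab) h2.
  have := subseq_uniq ab uq; rewrite /= inE andbT => ba.
  have xa : x != a by apply: contraNneq xq => ->.
  by move: (h1 ltac:(lia)); lia.
have sub3' a b c : subseq [:: a; b; c] q' -> subseq [:: a; b; c] (x :: q).
  by move=> h; apply: sub3; rewrite qE; apply: subseq_trans h (suffix_subseq _ _).
move: (uq); rewrite qE cat_uniq => /and3P[_ /hasPn disj uq'].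
have [|||||||h [w [wG q'E]]] := IH q' G (M + g.+1) _ uq'; try by [lia].
- by move: len; rewrite qE /= size_cat; lia.
- move=> y; have := memq' y; rewrite qE mem_cat mem_down.
  have := disj y; case: (y \in q') => [/(_ isT)|_].
    by rewrite mem_down; lia.
  by lia.
- by move: dec; rewrite /= qE pairwise_cat => /andP[_ /and3P[]].
- by move=> a b c /sub3'; apply: no312.
- by move=> a b c /sub3' h xc; apply: no231 h _; lia.
exists 0, ((g, h) :: w); split=> //.
by rewrite subn0 down0 /= downS q'E -xE /= !catA.
Qed.

Lemma layered_inj h h' w w' G M : h + small w = G -> h' + small w' = G -> G <= M ->
  down (G - h) h ++ layered (G - h) M w = down (G - h') h' ++ layered (G - h') M w' ->
  h = h' /\ w = w'.
Proof.
elim: w w' h h' G M => [|[g k] w IH] w' h h' G M hG h'G GM E.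
(* The index of the first large letter recovers the number of small letters before it. *)
all: have find_small k' v : k' + small v = G ->
    find (fun x => M < x) (down (G - k') k' ++ layered (G - k') M v) = k'
  by move=> kG; rewrite find_cat ifN; [
    rewrite size_down; case: v kG => [|[g' k''] v] kG /=;
      rewrite ?addn0 // downS /= ifT ?addn0 //; lia
  | by apply/hasPn => x; rewrite mem_down; lia].
all: have hh : h = h' by rewrite -(find_small _ _ hG) E find_small.
all: split=> //; move: E h'G; rewrite -hh => /(congr1 (drop h)).
all: rewrite !drop_size_cat ?size_down //; case: w' => [|[g' k'] w'] //=.
- by rewrite downS.
- by rewrite downS.
rewrite !downS => -[gg E h'G].
have {}gg : g = g' by lia.
move: E; rewrite -{}gg in h'G * => /(congr1 (drop g)).
rewrite -!catA !drop_size_cat ?size_down // => E.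
rewrite !small_cons in hG h'G.
by have [|||-> ->] := IH w' k k' (G - h) (M + g.+1) _ _ _ E; try lia.
Qed.

(** * Ternary trees *)

Inductive ternary := Tip | Fork of ternary & ternary & ternary.

Fixpoint nodes t := if t is Fork a b c then (nodes a + nodes b + nodes c).+1 else 0.

(* A ternary tree is an ordered forest in which the list of children of every
   vertex is cut in two: in [Fork a b c], the first root has the roots of [a],
   then those of [b], as children, and [c] is the rest of the forest; [roots]
   counts the roots, and [code] lists the numbers of children in preorder. *)
Fixpoint roots t := if t is Fork _ _ c then (roots c).+1 else 0.

Fixpoint code t :=
  if t is Fork a b c then (roots a, roots b) :: code a ++ code b ++ code c else [::].

Lemma size_code t : size (code t) = nodes t.
Proof. by elim: t => //= a IHa b IHb c IHc; rewrite !size_cat IHa IHb IHc addnA. Qed.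

Lemma lukasiewicz_code t r w :
  lukasiewicz (roots t + r) (code t ++ w) = lukasiewicz r w.
Proof.
elim: t r w => //= a IHa b IHb c IHc r w.
have -> : roots c + r + (roots a + roots b) = roots a + (roots b + (roots c + r)) by lia.
by rewrite -!catA IHa IHb IHc.
Qed.

(** The first pair [(g, h)] is the first root; forests with [g], [h] and [k] roots are then read off
    in turn. *)
Lemma lukasiewicz_split k r w : lukasiewicz (k + r) w ->
  exists t w', [/\ roots t = k, w = code t ++ w' & lukasiewicz r w'].
Proof.
have [n] := ubnP (size w); elim: n k r w => // n IH [|k] r w len luk.
  by exists Tip, w.
case: w len luk => [|[g h] w] //= len luk.
have [||a [w1 [ga w1E]]] := IH g (h + (k + r)) w; first by [].
  by move: luk; congr (is_true (lukasiewicz _ _)); lia.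
move=> {}luk; move: len; rewrite w1E size_cat => len.
have [|b [w2 [hb w2E]]] := IH h (k + r) w1 _ luk; first by lia.
move=> {}luk; move: len; rewrite w2E size_cat => len.
have [|c [w3 [kc w3E {}luk]]] := IH k r w2 _ luk; first by lia.
by exists (Fork a b c), w3; rewrite /= ga hb kc w3E !catA.
Qed.

Lemma code_surj r w : lukasiewicz r w -> exists2 t, roots t = r & code t = w.
Proof.
move=> luk; have [|t [[|[g h] w'] [rt -> //]]] := @lukasiewicz_split r 0 w.
  by rewrite addn0.
by exists t; rewrite ?cats0.
Qed.

Lemma code_inj t t' w w' : roots t = roots t' -> code t ++ w = code t' ++ w' ->
  t = t' /\ w = w'.
Proof.
elim: t t' w w' => [|a IHa b IHb c IHc] [|a' b' c'] //= w w' [rc] [ra rb].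
rewrite -!catA => /(IHa _ _ _ ra)[-> /(IHb _ _ _ rb)[->]].
by case/(IHc _ _ _ rc)=> -> ->.
Qed.

(** Every vertex is either one of the [r] roots or a child of exactly one vertex. *)
Lemma lukasiewicz_size r w : lukasiewicz r w -> size w = r + sumn (unzip1 w) + small w.
Proof.
elim: w r => [|[g h] w IH] r /=; first by move/eqP->.
by case/andP=> r0 /IH; rewrite small_cons; lia.
Qed.

(** The added pair [(0, roots t)] stands for the first letter [G + 1] and the small letters before
    the next layer, whose number is the initial Lukasiewicz count. *)
Definition perm_of_tree t :=
  let G := roots t + small (code t) in layered G G ((0, roots t) :: code t).

Lemma perm_of_tree_inj : injective perm_of_tree.
Proof.
move=> t t'; rewrite /perm_of_tree /= => -[GG]; rewrite -GG => E.
have [||rr cc] := layered_inj (erefl _) _ _ E; [by rewrite GG | by rewrite leq_addr |].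
by have [] := @code_inj t t' [::] [::] rr; rewrite ?cats0.
Qed.

Lemma perm_of_tree_U t : 
  U (2 * nodes t + 1) [:: 3; 1; 2] [:: 1; 3; 4; 2] (perm_of_tree t).
Proof.
set w := code t; set G := roots t + small w; set w' := (0, roots t) :: w.
have wG : small w' = G by [].
have luk : lukasiewicz (roots t) w.
  by rewrite -[roots t]addn0 -[w]cats0 lukasiewicz_code.
have sw := lukasiewicz_size luk.
have pE : perm_eq (perm_of_tree t) (iota 1 (2 * nodes t + 1)).
  apply: perm_trans (perm_layered _ wG) _; rewrite -add1n -iotaD.
  by rewrite -size_code -/w /large /= -/w; apply/permP => a; congr (count _ (iota _ _));
    lia.
have av : avoids (perm_of_tree t) [:: 3; 1; 2].
  by apply/avoids312P => a b c; apply: layered_no312.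
have pp : is_permutation (perm_of_tree t).
  rewrite /is_permutation (perm_uniq pE) iota_uniq (perm_all _ pE).
  by apply/allP => x; rewrite mem_iota; lia.
split=> //.
  apply/uniquely_sorted_balanced => //; rewrite /perm_of_tree /= leqnn.
  rewrite balanced_cat ?size_down; last first.
    by rewrite /= pairwise_down andbT; apply/allP => x; rewrite mem_down; lia.
  rewrite add1n balanced_layered -/w //; [by lia | by lia |].
  have := mem_last G.+1 (down (G - roots t) (roots t)).
  move: (last _ _) => z; rewrite inE addn1 => /predU1P[->|]; first exact: leqnn.
  by rewrite mem_down; lia.
apply/avoids1342P => a b c d sub.
apply/negP => /and3P[ad db bc].
have GG : G <= G by [].
(* The letters [b], [c], [d] form a 231, so [d] is small; but a small letter is below all letters
   before it, against [a < d]. *)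
have dG : d <= G.
  apply: (@layered_no231 G G w' b c d) => //; last by rewrite db.
  by apply: subseq_trans sub; apply: subseq_cons.
have := subseq_pairwise sub (pairwise_layered wG GG).
by rewrite [pairwise _ _]/=; case/andP=> /and4P[_ _ /implyP/(_ dG)]; lia.
Qed.

Lemma perm_of_tree_surj k p : U (2 * k + 1) [:: 3; 1; 2] [:: 1; 3; 4; 2] p ->
  exists2 t, nodes t = k & perm_of_tree t = p.
Proof.
case=> pE us av312 av1342.
have pp : is_permutation p.
  rewrite /is_permutation (perm_uniq pE) iota_uniq (perm_all _ pE).
  by apply/allP => x; rewrite mem_iota; lia.
have p0 : p != [::] by rewrite -size_eq0 (perm_size pE) size_iota addn1.
move/(uniquely_sorted_balanced pp p0 av312): us.
move/avoids312P: av312 => no312; move/avoids1342P: av1342 => no1342.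
have memp x : (x \in p) = (0 < x <= 2 * k + 1) by rewrite (perm_mem pE) mem_iota; lia.
have up : uniq p by case/andP: pp.
case: p p0 memp up no312 no1342 pE {pp} => // x q _ memp uxq no312 no1342 pE bal.
have := uxq; rewrite cons_uniq => /andP[xq uq].
have sub3 a b c : subseq [:: a; b; c] q -> subseq [:: a; b; c] (x :: q).
  by move=> h; apply: subseq_trans h (subseq_cons _ _).
have xn : 0 < x <= 2 * k + 1 by rewrite -memp mem_head.
(* The first letter [x] turns an increasing pair below it into a 312, and a 231 above it into a
   1342. *)
have [||||||h [w [wG qE]]] := @layered_surj (2 * k + 1) q x.-1 x uq; try by [lia].
- move=> y; have := memp y; rewrite inE.
  have [->|yx /= ->] := eqVneq y x; last by lia.
  by rewrite (negPf xq); lia.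
- apply: pairwise_subseq2 => b c bc; apply/implyP => cx.
  have := no312 x b c; rewrite /= eqxx => /(_ bc).
  by have := subseq_uniq bc uq; rewrite /= inE andbT; lia.
- by move=> a b c /sub3; apply: no312.
- move=> a b c abc xc; have := no1342 x a b c; rewrite /= eqxx => /(_ abc).
  by rewrite xc; lia.
have xE : x.-1.+1 = x by lia.
have luk : lukasiewicz h w.
  move: bal; rewrite /= leqnn qE balanced_cat; last first.
    by rewrite /= pairwise_down andbT; apply/allP => y; rewrite mem_down; lia.
  rewrite size_down add1n balanced_layered //; try by [lia].
  have := mem_last x (down (x.-1 - h) h).
  move: (last _ _) => z; rewrite inE => /predU1P[->|]; first exact: leqnn.
  by rewrite mem_down; lia.
have [t rt cw] := code_surj luk.
have pt : perm_of_tree t = x :: q.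
  by rewrite /perm_of_tree rt cw wG qE /= xE addn1 xE.
exists t => //.
have :=
  perm_size (perm_layered (roots t + small (code t)) (erefl (small ((0, roots t) :: code t)))).
rewrite -/(perm_of_tree t) pt (perm_size pE) size_cat !size_iota.
have := lukasiewicz_size luk; rewrite -cw size_code /small /large /= size_code -rt.
lia.
Qed.

(** * Intervals of noncrossing partitions *)

(* [s] codes the noncrossing partition of [0 .. size s - 1] in which the block
   of [i] has maximum [i + nth 0 s i]. *)
Definition bracket (s : seq nat) := forall i, i < size s ->
  i + nth 0 s i < size s /\
  forall t, t <= nth 0 s i -> t + nth 0 s (i + t) <= nth 0 s i.

(* Refinement of the coded partitions: the maximum of the [r]-block of [i] lies
   in the [c]-block of [i]. *)
Definition finer (r c : seq nat) := forall i, i < size r ->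
  nth 0 r i + nth 0 c (i + nth 0 r i) = nth 0 c i.

(* The block of the last point is merged with a block whose maximum is [b]
   positions further. *)
Definition raise b (s : seq nat) : seq nat :=
  mkseq (fun i => if i + nth 0 s i == (size s).-1 then nth 0 s i + b else nth 0 s i)
        (size s).

(* The restriction of the partition to the first [n] points. *)
Definition cut n (s : seq nat) : seq nat :=
  mkseq (fun i => minn (nth 0 s i) (n.-1 - i)) n.

Lemma size_raise b s : size (raise b s) = size s. Proof. exact: size_mkseq. Qed.

Lemma size_cut n s : size (cut n s) = n. Proof. exact: size_mkseq. Qed.

Lemma nth_raise b s i : i < size s ->
  nth 0 (raise b s) i = if i + nth 0 s i == (size s).-1 then nth 0 s i + b else nth 0 s i.
Proof. exact: nth_mkseq. Qed.

Lemma nth_cut n s i : i < n -> nth 0 (cut n s) i = minn (nth 0 s i) (n.-1 - i).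
Proof. exact: nth_mkseq. Qed.

Lemma bracket_cat u v : bracket u -> bracket v -> bracket (u ++ v).
Proof.
move=> bu bv i; rewrite size_cat nth_cat => iuv; case: (ltnP i) => [iu|ui].
  have [h1 h2] := bu i iu; split=> [|t tu]; first by lia.
  by rewrite nth_cat ifT; [apply: h2 | lia].
have [|h1 h2] := bv (i - size u); first by lia.
split=> [|t tv]; first by lia.
by rewrite nth_cat ifN -?leqNgt;
  [rewrite (_ : _ + t - _ = i - size u + t) ?h2; lia | lia].
Qed.

Lemma bracket_cons u : bracket u -> bracket (size u :: u).
Proof.
move=> bu [_|i iu] /=; last by have [h1 h2] := bu i iu; split.
by split=> // -[|t] //= tu; have [] := bu t tu; lia.
Qed.

Lemma bracket_raise u v : bracket u -> bracket v -> bracket (raise (size v) u ++ v).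
Proof.
move=> bu bv i; rewrite size_cat size_raise nth_cat size_raise => iuv;
  case: (ltnP i) => [iu|ui].
  have [h1 h2] := bu i iu; rewrite nth_raise //; case: ifP => /eqP ie.
    split=> [|t tu]; first by lia.
    rewrite nth_cat size_raise; case: (ltnP (i + t)) => [itu|uit].
      have := h2 t ltac:(lia); rewrite nth_raise //; case: ifP => _; lia.
    by have [|h _] := bv (i + t - size u); lia.
  split=> [|t tu]; first by lia.
  rewrite nth_cat size_raise ifT; last by lia.
  have := h2 t tu; rewrite nth_raise; last by lia.
  by case: eqP; lia.
have [|h1 h2] := bv (i - size u); first by lia.
split=> [|t tv]; first by lia.
rewrite nth_cat size_raise ifN -?leqNgt; last by lia.
by rewrite (_ : _ + t - _ = i - size u + t) ?h2; lia.
Qed.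

Lemma bracket_drop n s : bracket s -> bracket (drop n s).
Proof.
move=> bs i; rewrite size_drop nth_drop => ins.
have [|h1 h2] := bs (n + i); first by lia.
by split=> [|t /h2]; [lia | rewrite nth_drop addnA].
Qed.

Lemma bracket_take n s : n <= size s -> (forall i, i < n -> i + nth 0 s i < n) ->
  bracket s -> bracket (take n s).
Proof.
move=> ns sn bs i; rewrite size_takel // => lin; rewrite nth_take //.
have [|h1 h2] := bs i; first by lia.
split=> [|t ti]; first exact: sn.
by rewrite nth_take ?h2 //; have := sn i lin; lia.
Qed.

Lemma bracket_cut n s : n <= size s -> bracket s -> bracket (cut n s).
Proof.
move=> ns bs i; rewrite size_cut => lin; rewrite nth_cut //.
have [|h1 h2] := bs i; first by lia.
split=> [|t]; first by lia.
by rewrite leq_min => /andP[/h2 ti tn]; rewrite nth_cut; lia.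
Qed.

Lemma cut_raise b s : bracket s -> cut (size s) (raise b s) = s.
Proof.
move=> bs; apply: (@eq_from_nth _ 0); rewrite size_cut // => i lis.
have [h _] := bs i lis; rewrite nth_cut // nth_raise //.
by case: eqP; lia.
Qed.

Lemma finer_cat r r' c c' : bracket r -> size r = size c ->
  finer r c -> finer r' c' -> finer (r ++ r') (c ++ c').
Proof.
move=> br rc frc frc' i; rewrite size_cat !nth_cat -rc => irr; case: (ltnP i) => [ir|ri].
  by have [h _] := br i ir; rewrite ifT //; apply: frc.
rewrite ifN; last by lia.
have := frc' (i - size r) ltac:(lia).
by rewrite addnC -addnBAC // addnC.
Qed.

Lemma nth_cons_pred (x y : nat) s i : 0 < i -> nth x (y :: s) i = nth x s i.-1.
Proof. by case: i. Qed.

Lemma finer_fork r r' c c' : bracket r -> size r = size c -> size r' = size c' ->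
  bracket c -> finer r c -> finer r' c' ->
  finer (size r :: r ++ r') (size r + size r' :: raise (size r') c ++ c').
Proof.
move=> br rc rc' bc frc frc'; have frr : finer (r ++ r') (raise (size r') c ++ c').
  apply: finer_cat => //; rewrite ?size_raise // => i ir.
  have [h _] := br i ir; rewrite !nth_raise -?rc //.
  (* A point and the maximum of its [r]-block share a [c]-block, so both are raised or neither
     is. *)
  by rewrite -addnA frc //; case: ifP => _; rewrite ?addnA frc.
move=> [_|i] //=; last exact: frr.
case: (posnP (size r)) => [->|r0]; first by rewrite !add0n.
rewrite add0n nth_cons_pred // nth_cat size_raise -rc ifT; last by lia.
rewrite nth_raise -?rc; last by lia.
have [] := bc (size r).-1; first by lia.
by rewrite -rc; case: eqP; lia.
Qed.

(** * The interval of noncrossing partitions coded by a ternary tree *)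

Fixpoint lower t : seq nat :=
  if t is Fork a b c then nodes a :: lower a ++ lower b ++ lower c else [::].

(** The last point of [a] is the maximum of the finer block of 0, so its coarser block must be that
    of 0, which ends with the last point of [b]; hence [raise]. *)
Fixpoint upper t : seq nat :=
  if t is Fork a b c then
    nodes a + nodes b :: raise (nodes b) (upper a) ++ upper b ++ upper c
  else [::].

Lemma size_lower t : size (lower t) = nodes t.
Proof. by elim: t => //= a IHa b IHb c IHc; rewrite !size_cat IHa IHb IHc addnA. Qed.

Lemma size_upper t : size (upper t) = nodes t.
Proof.
by elim: t => //= a IHa b IHb c IHc; rewrite !size_cat size_raise IHa IHb IHc addnA.
Qed.

Lemma bracket_lower t : bracket (lower t).
Proof.
elim: t => //= a IHa b IHb c IHc.
rewrite -size_lower -cat_cons; apply: bracket_cat; first exact: bracket_cons.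
exact: bracket_cat.
Qed.

Lemma bracket_upper t : bracket (upper t).
Proof.
elim: t => //= a IHa b IHb c IHc; rewrite catA -cat_cons; apply: bracket_cat => //.
have := bracket_cons (bracket_raise IHa IHb).
by rewrite size_cat size_raise !size_upper.
Qed.

Lemma finer_tree t : finer (lower t) (upper t).
Proof.
elim: t => //= a IHa b IHb c IHc; rewrite !catA -!cat_cons.
have szE t' : size (lower t') = size (upper t') by rewrite size_lower size_upper.
have := @finer_fork (lower a) (lower b) (upper a) (upper b).
rewrite -!szE !size_lower => h; apply: finer_cat => //.
- rewrite -size_lower; apply: bracket_cat; last exact: bracket_lower.
  exact/bracket_cons/bracket_lower.
- by rewrite /= !size_cat size_raise !szE.
- by apply: h => //; [exact: bracket_lower | exact: bracket_upper].
Qed.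

Lemma cat_inj (s1 s2 s1' s2' : seq nat) : size s1 = size s1' ->
  s1 ++ s2 = s1' ++ s2' -> s1 = s1' /\ s2 = s2'.
Proof. by move=> sz /eqP; rewrite eqseq_cat // => /andP[/eqP-> /eqP->]. Qed.

Lemma lower_upper_inj t t' : lower t = lower t' -> upper t = upper t' -> t = t'.
Proof.
elim: t t' => [|a IHa b IHb c IHc] [|a' b' c'] //= [aa lE] [abE uE].
have bb : nodes b = nodes b' by lia.
have [|la] := cat_inj _ lE; rewrite ?size_lower //.
move=> /cat_inj[|lb lc]; rewrite ?size_lower //.
have [|ua] := cat_inj _ uE; rewrite ?size_raise ?size_upper //.
move=> /cat_inj[|ub uc]; rewrite ?size_upper //.
rewrite (IHb b') // (IHc c') // (IHa a') //.
rewrite -(cut_raise (nodes b) (@bracket_upper a)) ua !size_upper aa.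
by rewrite -(size_upper a') cut_raise //; apply: bracket_upper.
Qed.

(** The heads [i <= j] give the cutting points. By nesting and refinement, all entries stay within
    their pieces except those of [c] on the first piece, which are truncated by [cut]. *)
Lemma lower_upper_surj r c : bracket r -> bracket c -> size r = size c -> finer r c ->
  exists t, lower t = r /\ upper t = c.
Proof.
have [n] := ubnP (size r); elim: n r c => // n IH [|i r] [|j c] //=.
  by exists Tip.
move=> len br bc [rc] frc.
have ij : i + nth 0 (j :: c) i = j by apply: (frc 0).
have [jc cj] := bc 0 isT; have [ir ri] := br 0 isT; rewrite /= !add0n in jc cj ir ri.
have br' : bracket r by have := @bracket_drop 1 _ br; rewrite /= drop0.
have bc' : bracket c by have := @bracket_drop 1 _ bc; rewrite /= drop0.
have frc' : finer r c by move=> x; apply: (frc x.+1).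
have inr x : x < i -> x + nth 0 r x < i by move=> /ri /=; lia.
have inc x : x < j -> x + nth 0 c x < j by move=> /cj /=; lia.
have rgt x : i <= x -> x < j -> x + nth 0 r x < j.
  by move=> ix xj; have := frc' x ltac:(lia); have := inc x xj; lia.
have [|||||a [la ua]] := IH (take i r) (cut i c).
- by rewrite size_takel; lia.
- by apply: bracket_take => //; lia.
- by apply: bracket_cut => //; lia.
- by rewrite size_takel ?size_cut //; lia.
- move=> x; rewrite size_takel; last by lia.
  move=> xi; rewrite nth_take // !nth_cut //; last exact: inr.
  by have := frc' x ltac:(lia); have := inr x xi; lia.
have [|||||b [lb ub]] := IH (take (j - i) (drop i r)) (take (j - i) (drop i c)).
- by rewrite size_takel ?size_drop; lia.
- apply: bracket_take; rewrite ?size_drop; [lia | | exact: bracket_drop].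
  by move=> x xji; rewrite nth_drop; have := rgt (i + x); lia.
- apply: bracket_take; rewrite ?size_drop; [lia | | exact: bracket_drop].
  by move=> x xji; rewrite nth_drop; have := inc (i + x); lia.
- by rewrite !size_takel ?size_drop; lia.
- move=> x; rewrite size_takel ?size_drop; last by lia.
  move=> xji; have := rgt (i + x) ltac:(lia) ltac:(lia) => h.
  by rewrite !nth_take ?nth_drop; [rewrite addnA; apply: frc' | | |]; lia.
have [|||||e [le ue]] := IH (drop j r) (drop j c).
- by rewrite size_drop; lia.
- exact: bracket_drop.
- exact: bracket_drop.
- by rewrite !size_drop rc.
- by move=> x; rewrite size_drop => xj; rewrite !nth_drop addnA; apply: frc'; lia.
have na : nodes a = i by rewrite -size_upper ua size_cut.
have nb : nodes b = j - i by rewrite -size_upper ub size_takel ?size_drop; lia.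
exists (Fork a b e); rewrite /= la lb le ua ub ue na nb subnKC; last by lia.
have split_at (s : seq nat) : take i s ++ take (j - i) (drop i s) ++ drop j s = s.
  have -> : drop j s = drop (j - i) (drop i s) by rewrite drop_drop subnK //; lia.
  by rewrite !cat_take_drop.
split; first by rewrite split_at.
congr (_ :: _); rewrite -[RHS]split_at; congr (_ ++ _).
have sz : size (take i c) = i by rewrite size_takel; lia.
apply: (@eq_from_nth _ 0); rewrite size_raise size_cut ?sz // => x xi.
rewrite nth_raise ?size_cut // nth_cut // nth_take //.
have i0 : 0 < i by lia.
(* Without point 0, index [i.-1] is the point [i], whose coarser block ends at [j]. By nesting, an
   earlier entry reaching this point also ends at [j], so [raise] undoes the truncation. *)
have ci : nth 0 c i.-1 = j - i by move: ij; rewrite nth_cons_pred //; lia.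
have [|_ h] := bc' x; first by lia.
have := h (i.-1 - x); rewrite subnKC; last by lia.
by rewrite ci; have := inc x; case: eqP; lia.
Qed.

(** * Coding noncrossing partitions by block maxima *)

Section BracketOfPartition.
Variable k : nat.
Implicit Types (x y : NC k) (i j : 'I_k).

Definition block_max x i : nat := \max_(j in pblock x i) j.

Lemma NC_partition x : partition x [set: 'I_k].
Proof. by case/andP: (NC_prop x). Qed.

Lemma mem_block x i : i \in pblock x i.
Proof. by rewrite mem_pblock (cover_partition (NC_partition x)) inE. Qed.

Lemma block_mem x i : pblock x i \in NC_blocks x.
Proof. by rewrite pblock_mem // (cover_partition (NC_partition x)) inE. Qed.

Lemma block_eq x (B : {set 'I_k}) i : B \in NC_blocks x -> i \in B -> pblock x i = B.
Proof. by case/and3P: (NC_partition x) => _ tx _; apply: def_pblock. Qed.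

Lemma block_maxP x i : exists2 m, m \in pblock x i & block_max x i = m :> nat.
Proof.
have [|m mi e] := @eq_bigmax_cond _ (mem (pblock x i)) (fun j : 'I_k => j : nat);
  last by exists m.
by apply/card_gt0P; exists i; apply: mem_block.
Qed.

Lemma block_max_ge x i j : j \in pblock x i -> j <= block_max x i.
Proof. exact: leq_bigmax_cond. Qed.

(** A block contains its maximum, so blocks with equal maxima meet and hence coincide. *)
Lemma mem_block_max x i j : (j \in pblock x i) = (block_max x j == block_max x i).
Proof.
apply/idP/eqP=> [ji|E]; first by rewrite /block_max (block_eq (block_mem x i) ji).
have [m mi mE] := block_maxP x i; have [n nj nE] := block_maxP x j.
have mn : m = n by apply/val_inj; rewrite /= -mE -nE.
rewrite -(block_eq (block_mem x i) mi) mn (block_eq (block_mem x j) nj).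
exact: mem_block.
Qed.

Lemma noncrossingP (P : {set {set 'I_k}}) :
  reflect (forall B B', B \in P -> B' \in P -> B != B' ->
             forall a b c d, a \in B -> b \in B' -> c \in B -> d \in B' ->
               ~~ [&& a < b, b < c & c < d])
          (noncrossing P).
Proof.
apply: (iffP forall_inP) => H.
  move=> B B' BP BP' nB a b c d aB bB cB dB.
  move: (H B BP) => /forall_inP/(_ B' BP')/implyP/(_ nB)/forall_inP/(_ a aB).
  by move=> /forall_inP/(_ b bB)/forall_inP/(_ c cB)/forall_inP/(_ d dB).
move=> B BP; apply/forall_inP => B' BP'; apply/implyP => nB.
apply/forall_inP => a aB; apply/forall_inP => b bB; apply/forall_inP => c cB.
by apply/forall_inP => d dB; apply: (H B B').
Qed.

(** Otherwise [i], [j] and the maxima of their blocks would form a crossing. *)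
Lemma block_max_nested x i j : i <= j <= block_max x i -> block_max x j <= block_max x i.
Proof.
case/andP=> ij ji; rewrite leqNgt; apply/negP => lt.
have [m mi mE] := block_maxP x i; have [n nj nE] := block_maxP x j.
have /andP[_ /noncrossingP/(_ _ _ (block_mem x i) (block_mem x j))] := NC_prop x.
have nij : pblock x i != pblock x j.
  by apply: contraTneq lt => e; rewrite /block_max e ltnn.
move=> /(_ nij i j m n (mem_block x i) (mem_block x j) mi nj)/negP; apply.
have ij' : i != j :> nat by apply: contraNneq nij => /val_inj->.
have jm : j != m :> nat.
  apply: contraTneq lt => /val_inj e; move: mi; rewrite -e mem_block_max => /eqP->.
  by rewrite ltnn.
by rewrite -nE -mE; move: ij' jm; rewrite -mE; lia.
Qed.

Definition bracket_of x : seq nat := [seq block_max x i - i | i <- enum 'I_k].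

Lemma size_bracket_of x : size (bracket_of x) = k.
Proof. by rewrite size_map size_enum_ord. Qed.

Lemma nth_bracket_of x i : nth 0 (bracket_of x) i = block_max x i - i.
Proof. by rewrite (nth_map i) ?size_enum_ord // nth_ord_enum. Qed.

Lemma add_bracket_of x i : i + nth 0 (bracket_of x) i = block_max x i.
Proof. by rewrite nth_bracket_of subnKC // block_max_ge ?mem_block. Qed.

Lemma bracket_bracket_of x : bracket (bracket_of x).
Proof.
move=> n; rewrite size_bracket_of => nk; pose i := Ordinal nk.
rewrite (add_bracket_of x i) (nth_bracket_of x i).
have [m mi mE] := block_maxP x i; split=> [|t ti]; first by rewrite mE.
have tk : n + t < k by have := ltn_ord m; move: ti; rewrite mE /=; lia.
have := add_bracket_of x (Ordinal tk) => /= tE.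
have := @block_max_nested x i (Ordinal tk); rewrite -tE /=.
have iE : i = n :> nat by [].
by have := block_max_ge (mem_block x i); move: ti; rewrite iE; lia.
Qed.

Lemma bracket_of_inj : injective bracket_of.
Proof.
move=> x y xy; have E i : block_max x i = block_max y i.
  by rewrite -!add_bracket_of xy.
have blockE i : pblock x i = pblock y i.
  by apply/setP => j; rewrite !mem_block_max !E.
have sub (z z' : NC k) : (forall i, pblock z i = pblock z' i) ->
  NC_blocks z \subset NC_blocks z'.
  move=> zz; apply/subsetP => B Bz.
  have /set0Pn[i iB] : B != set0.
    by case/and3P: (NC_partition z) => _ _; apply: contraNneq => <-.
  by rewrite -(block_eq Bz iB) zz block_mem.
by apply/val_inj/eqP; rewrite eqEsubset !sub.
Qed.

Lemma bracket_of_finer x y : (x <= y)%O <-> finer (bracket_of x) (bracket_of y).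
Proof.
rewrite NC_leE; split=> [/refinesP xy n|fxy].
  rewrite size_bracket_of => nk; pose i := Ordinal nk.
  have [m mi mE] := block_maxP x i.
  have [C Cy /subsetP xC] := xy _ (block_mem x i).
  have := add_bracket_of y m; rewrite -mE -(add_bracket_of x i).
  rewrite /block_max (block_eq Cy (xC _ mi)) -(block_eq Cy (xC _ (mem_block x i))).
  by rewrite -/(block_max y i) -(add_bracket_of y i) /=; lia.
have bmE i m : m \in pblock x i -> block_max x i = m -> block_max y m = block_max y i.
  move=> mi mE; have := fxy i; rewrite size_bracket_of => /(_ (ltn_ord i)) e.
  rewrite -(add_bracket_of y i) -(add_bracket_of y m) -mE -{}e.
  by rewrite (add_bracket_of x i) -(add_bracket_of x i); lia.
apply/refinesP => B Bx.
have /set0Pn[i iB] : B != set0.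
  by case/and3P: (NC_partition x) => _ _; apply: contraNneq => <-.
exists (pblock y i); first exact: block_mem.
apply/subsetP => j; rewrite -(block_eq Bx iB) => ji.
have [m mi mE] := block_maxP x i.
rewrite mem_block_max -(bmE i m) // -(bmE j m) //.
  by rewrite (block_eq (block_mem x i) ji).
by rewrite -mE; apply/eqP; rewrite -mem_block_max.
Qed.

(** The blocks are the fibres of [f]. For a crossing [a < b < c < d], nesting gives [f b <= f a] and
    [f c <= f b], so the two fibres agree. Nesting also gives [f (f i) = f i], so [f i] is the
    maximum of the block of [i]. *)
Lemma bracket_of_surj s : bracket s -> size s = k -> exists x, bracket_of x = s.
Proof.
move=> bs sk; pose f i := i + nth 0 s i.
pose P := preim_partition f [set: 'I_k].
have pP : partition P setT by apply: preim_partitionP.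
have fk i : f i < k by have [] := bs i; rewrite ?sk.
have ff i t : i <= t <= f i -> t + nth 0 s t <= f i.
  move=> /andP[it tf]; have [|_ h] := bs i; first by rewrite sk.
  by have := h (t - i); rewrite subnKC //; move: tf; rewrite /f; lia.
have inP i j : (j \in pblock P i) = (f i == f j).
  apply: (@pblock_equivalence_partition _ [rel i j | f i == f j] setT) => //.
  by move=> a b c _ _ _ /=; split=> [|/eqP->].
have ncP : noncrossing P.
  apply/noncrossingP => B B' BP BP' nB a b c d aB bB cB dB.
  apply/negP => /and3P[ab bc cd]; case/and3P: pP => _ tP _.
  have BE := def_pblock tP BP aB; have BE' := def_pblock tP BP' bB.
  have /eqP ac : f a == f c by rewrite -inP BE.
  have /eqP bd : f b == f d by rewrite -inP BE'.
  have := ff a b; have := ff b c; rewrite -/(f b) -/(f c) => h1 h2.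
  have cf : c <= f c := leq_addr _ _; have df : d <= f d := leq_addr _ _.
  have fa : f a = f b by lia.
  by move/negP: nB; apply; rewrite -BE -BE'; apply/eqP/same_pblock; rewrite // inP fa.
have nc : is_NC P by rewrite /is_NC pP.
exists (MkNC nc); apply: (@eq_from_nth _ 0); rewrite size_bracket_of // => n nk.
pose i := Ordinal nk; rewrite (nth_bracket_of _ i).
suff -> : block_max (MkNC nc) i = f i by rewrite /f addKn.
apply/eqP; rewrite eqn_leq; apply/andP; split.
  by apply/bigmax_leqP => j /=; rewrite inP => /eqP->; rewrite leq_addr.
apply: (@block_max_ge (MkNC nc) i (Ordinal (fk i))); rewrite /= inP.
have := ff i (f i); rewrite leqnn leq_addr => /(_ isT).
by rewrite [f (Ordinal _)]/f /= => h; apply/eqP; lia.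
Qed.

End BracketOfPartition.

Theorem theorem7p1 (k : nat) :
  exists Upsilon : seq nat -> NC k * NC k,
    set_bij (U (2 * k + 1) [:: 3; 1; 2] [:: 1; 3; 4; 2]) (Int (NC k)) Upsilon.
Proof.
(* The partition into singletons serves as a default value for words outside the domain. *)
have [x0 _] : exists x0 : NC k, bracket_of x0 = nseq k 0.
  apply: bracket_of_surj; rewrite ?size_nseq // => i; rewrite size_nseq => ik.
  rewrite nth_nseq ik addn0; split=> // t; rewrite leqn0 => /eqP->.
  by rewrite addn0 nth_nseq ik.
have /choice[Ups UpsP] : forall p, exists xy : NC k * NC k,
    U (2 * k + 1) [:: 3; 1; 2] [:: 1; 3; 4; 2] p ->
    exists t, [/\ perm_of_tree t = p, bracket_of xy.1 = lower t & bracket_of xy.2 = upper t].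
  move=> p; have [Up|nU] := pselect (U (2 * k + 1) [:: 3; 1; 2] [:: 1; 3; 4; 2] p);
    last by exists (x0, x0).
  have [t tk tp] := perm_of_tree_surj Up.
  have [|x xE] := @bracket_of_surj k _ (@bracket_lower t); first by rewrite size_lower.
  have [|y yE] := @bracket_of_surj k _ (@bracket_upper t); first by rewrite size_upper.
  by exists (x, y) => _; exists t.
exists Ups; split.
- move=> p /UpsP[t [_ xE yE]]; rewrite /Int /=.
  by apply/bracket_of_finer; rewrite xE yE; apply: finer_tree.
- move=> p q; rewrite !in_setE => /UpsP[t [<- xE yE]] /UpsP[t' [<- xE' yE']] E.
  by congr perm_of_tree; apply: lower_upper_inj; rewrite -?xE -?yE E.
move=> [x y] /bracket_of_finer xy.
have [t [xE yE]] : exists t, lower t = bracket_of x /\ upper t = bracket_of y.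
  by apply: lower_upper_surj; rewrite ?size_bracket_of //; apply: bracket_bracket_of.
have tk : nodes t = k by rewrite -size_lower xE size_bracket_of.
have Ut := perm_of_tree_U t; rewrite tk in Ut.
exists (perm_of_tree t) => //.
have [t' [/perm_of_tree_inj-> xE' yE']] := UpsP _ Ut.
rewrite xE in xE'; rewrite yE in yE'.
by case: (Ups _) xE' yE' => a b /= /bracket_of_inj-> /bracket_of_inj->.
Qed.
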